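(* Let $T$ be a self-adjoint operator in a complex Hilbert space $\mathcal H$ and let $A$ be a $T$-bounded linear operator in $\mathcal H$ with $T$-bound $0$. Then for every $\varepsilon>0$ there exists $r_\varepsilon>0$ such that $$\sigma(T+A)\subset K(0,r_\varepsilon)\cup\Sigma_\varepsilon\cup(-\Sigma_\varepsilon),$$ where $K(0,r_\varepsilon):=\{z\in\mathbb C:|z|\le r_\varepsilon\}$ and $\Sigma_\varepsilon:=\{z\in\mathbb C\setminus\{0\}:|\arg z|\le\varepsilon\}$.
   Context: $\mathcal D(\cdot)$ denotes the domain. A linear operator $A$ (not necessarily symmetric, closed or bounded) is $T$-bounded if $\mathcal D(T)\subset\mathcal D(A)$ and there are $a,b\ge0$ with $\|Ax\|^2\le a^2\|x\|^2+b^2\|Tx\|^2$ for all $x\in\mathcal D(T)$; the infimum of all $b\ge 0$ for which such an $a\ge 0$ exists is the $T$-bound of $A$. The operator $T+A$ has domain $\mathcal D(T)$. *)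

(* Defs.v *)
From HB Require Import structures.
From mathcomp Require Import all_boot all_order all_algebra.
From mathcomp Require Import all_classical all_reals all_analysis.
From mathcomp Require Export complex.

Set Implicit Arguments.
Unset Strict Implicit.
Unset Printing Implicit Defensive.

Import Order.TTheory GRing.Theory Num.Theory numFieldNormedType.Exports.

Local Open Scope classical_set_scope.
Local Open Scope ring_scope.
Local Open Scope complex_scope.

(* A complex Hilbert space is a complete normed space over R[i] together with
   an inner product (linear in the first argument) that induces its norm. *)
Definition induces_norm (R : realType) (H : completeNormedModType R[i])
    (dot : {dot H for Num.conj}) : Prop :=
  forall x : H, `|x| ^+ 2 = dot x x.

Section UnboundedOperators.
Variables (R : realType) (H : completeNormedModType R[i]).

(* Only the values of [op_fun] on [dom] are meaningful. *)
Record operator := Operator { dom : set H; op_fun :> H -> H }.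

Definition linear_operator (S : operator) : Prop :=
  [/\ dom S 0,
      forall (c : R[i]) x y, dom S x -> dom S y -> dom S (c *: x + y)
    & forall (c : R[i]) x y, dom S x -> dom S y ->
        S (c *: x + y) = c *: S x + S y].

Definition op_graph (S : operator) : set (H * H) :=
  [set p | dom S p.1 /\ S p.1 = p.2].

(* The pairs (y, z) with <S x, y> = <x, z> for all x in the domain of S; when
   that domain is dense this is the graph of the adjoint of S. *)
Definition adjoint_graph (dot : {dot H for Num.conj}) (S : operator) :
    set (H * H) :=
  [set p | forall x, dom S x -> dot (S x) p.1 = dot x p.2].

Definition self_adjoint (dot : {dot H for Num.conj}) (S : operator) : Prop :=
  dense (dom S) /\ adjoint_graph dot S = op_graph S.

Definition relative_bounds (T A : operator) : set R :=
  [set b | 0 <= b /\ exists2 a : R, 0 <= a & forall x, dom T x ->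
     `|A x| ^+ 2 <= a%:C ^+ 2 * `|x| ^+ 2 + b%:C ^+ 2 * `|T x| ^+ 2].

Definition relatively_bounded (T A : operator) : Prop :=
  dom T `<=` dom A /\ relative_bounds T A !=set0.

Definition relative_bound (T A : operator) : R := inf (relative_bounds T A).

Definition perturb (T A : operator) : operator :=
  Operator (dom T) (fun x => T x + A x).

(* l is in the resolvent set when S - l : dom S -> H has an everywhere defined
   bounded inverse B. *)
Definition resolvent_set (S : operator) : set R[i] :=
  [set l | exists B : {linear H -> H},
    [/\ exists M : R, forall y, `|B y| <= M%:C * `|y|,
        forall y, dom S (B y) /\ S (B y) - l *: B y = y
      & forall x, dom S x -> B (S x - l *: x) = x]].

Definition spectrum (S : operator) : set R[i] := ~` resolvent_set S.

End UnboundedOperators.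

Section Sector.
Variable R : realType.

(* Principal argument, with values in ]-pi, pi] for z != 0; see [argP]. *)
Definition arg (z : R[i]) : R :=
  let t := acos (complex.Re z / complex.Re `|z|) in
  if 0 <= complex.Im z then t else - t.

Lemma argP (z : R[i]) : z != 0 ->
  - pi < arg z <= pi /\ z = `|z| * (cos (arg z) +i* sin (arg z)).
Proof.
case: z => x y z0; rewrite /arg normc_def /=.
set r := Num.sqrt _.
have r2 : r ^+ 2 = x ^+ 2 + y ^+ 2 by rewrite sqr_sqrtr// addr_ge0// sqr_ge0.
have r0 : 0 < r.
  rewrite lt_neqAle sqrtr_ge0 andbT eq_sym -sqrf_eq0 r2.
  rewrite paddr_eq0 ?sqr_ge0// !sqrf_eq0.
  by apply: contra z0 => /andP[/eqP -> /eqP ->].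
have rn0 : r != 0 by rewrite gt_eqF.
set q := x / r.
have s2 : 1 - q ^+ 2 = (y / r) ^+ 2.
  apply: (mulIf (expf_neq0 2 rn0)); rewrite mulrBl mul1r -!exprMn !divfK//.
  by rewrite r2 addrC addKr.
have q1 : -1 <= q <= 1.
  by rewrite -ler_norml -(@ler_pXn2r _ 2)// ?nnegrE// expr1n real_normK
    ?num_real// -subr_ge0 s2 sqr_ge0.
have sinE : sin (acos q) = `|y| / r.
  by rewrite sin_acos// s2 sqrtr_sqr normrM normfV (gtr0_norm r0).
have qr : r * q = x by rewrite mulrC divfK.
have yr : r * (`|y| / r) = `|y| by rewrite mulrC divfK.
have [y0|y0] := leP 0 y.
  split; first by rewrite acos_lepi// andbT (lt_le_trans _ (acos_ge0 q1))//
    oppr_lt0 pi_gt0.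
  by rewrite acosK ?in_itv// sinE; simpc; rewrite qr yr ger0_norm.
split; last first.
  rewrite cosN sinN acosK ?in_itv// sinE; simpc.
  by rewrite qr yr ltr0_norm// opprK.
rewrite ltrN2 acos_ltpi /=; last first.
  case/andP: q1 => qN1 ->; rewrite andbT lt_neqAle qN1 andbT.
  apply: contraTneq y0 => qE; rewrite -leNgt.
  move: s2; rewrite -qE sqrrN expr1n subrr => /esym/eqP.
  by rewrite sqrf_eq0 mulf_eq0 invr_eq0 (negbTE rn0) orbF => /eqP ->.
by rewrite (le_trans _ (pi_ge0 R))// oppr_le0 acos_ge0.
Qed.

Definition closed_disk0 (r : R) : set R[i] := [set z | `|z| <= r%:C].

Definition sector (e : R) : set R[i] := [set z | z != 0 /\ `|arg z| <= e].

Definition opp_sector (e : R) : set R[i] := [set - z | z in sector e].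

End Sector.

(* Main.v *)
(* For z = x + iy with y <> 0, self-adjointness gives |y| |u| <= |(T - z) u| and
   makes T - z bijective: its range is closed, and a vector w orthogonal to it
   satisfies T w = conj(z) w, hence w = 0 by the same bound at conj(z). Outside
   the double sector |y| >= s |z| for some s > 0 depending on eps, so
   |T u| <= (1 + 1/s) |(T - z) u|, and a T-bound smaller than s / (4 (s + 1))
   together with |z| large makes |A u| <= |(T - z) u| / 2. Then 1 + A (T - z)^-1
   is onto, and T + A - z = (1 + A (T - z)^-1) (T - z) has a bounded inverse. *)
From HB Require Import structures.
Require Import Defs.
From mathcomp Require Import all_boot all_order all_algebra.
From mathcomp Require Import all_classical all_reals all_analysis.
From mathcomp Require Import complex.
From mathcomp Require Import ring lra.
Import Order.TTheory GRing.Theory Num.Theory numFieldNormedType.Exports.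

Local Open Scope classical_set_scope.
Local Open Scope ring_scope.
Local Open Scope complex_scope.

(** * Real-valued norms, and convergence measured by them *)

Section RealNorm.
Context {R : realType}.

(* The norm of [V] takes its values in [R[i]]. *)
Definition rnorm {V : normedZmodType R[i]} (x : V) : R := complex.Re `|x|.

Section Zmod.
Context {V : normedZmodType R[i]}.
Implicit Types x y : V.

Lemma rnormE x : (rnorm x)%:C = `|x|.
Proof. exact: RRe_real (normr_real x). Qed.

Lemma rnorm_ge0 x : 0 <= rnorm x.
Proof. by rewrite -lecR rnormE normr_ge0. Qed.

Lemma rnorm0_eq0 x : rnorm x = 0 -> x = 0.
Proof. by move=> x0; apply/eqP; rewrite -normr_eq0 -rnormE x0. Qed.

Lemma rnorm_gt0 x : x != 0 -> 0 < rnorm x.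
Proof. by rewrite -normr_gt0 -rnormE ltcR. Qed.

Lemma rnorm0 : rnorm (0 : V) = 0.
Proof. by rewrite /rnorm normr0. Qed.

Lemma rnormN x : rnorm (- x) = rnorm x.
Proof. by rewrite /rnorm normrN. Qed.

Lemma rdistC x y : rnorm (x - y) = rnorm (y - x).
Proof. by rewrite /rnorm distrC. Qed.

Lemma ler_rnormD x y : rnorm (x + y) <= rnorm x + rnorm y.
Proof. rewrite -lecR rmorphD /= !rnormE; exact: ler_normD. Qed.

Lemma ler_rnormB x y : rnorm (x - y) <= rnorm x + rnorm y.
Proof. by rewrite -(rnormN y) ler_rnormD. Qed.

Lemma ler_rdistD z x y : rnorm (x - y) <= rnorm (x - z) + rnorm (z - y).
Proof. by rewrite -lecR rmorphD /= !rnormE ler_distD. Qed.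

End Zmod.

Lemma rnormZ {V : normedModType R[i]} (a : R[i]) (x : V) :
  rnorm (a *: x) = rnorm a * rnorm x.
Proof. by apply: complexI; rewrite rmorphM /= !rnormE normrZ. Qed.

Lemma rnorm_real (a : R) : 0 <= a -> rnorm a%:C = a.
Proof. by move=> a0; rewrite /rnorm ger0_norm ?ler0c. Qed.

Lemma Im_le_rnorm (z : R[i]) : `|complex.Im z| <= rnorm z.
Proof.
rewrite /rnorm normc_def /= -sqrtr_sqr ler_wsqrtr // lerDr sqr_ge0 //.
Qed.

Lemma cvg_rnormP {V : normedModType R[i]} (u : nat -> V) (l : V) :
  u @ \oo --> l <->
  forall e : R, 0 < e -> exists N, forall n, (N <= n)%N -> rnorm (u n - l) < e.
Proof.
split.
  move=> /cvgrPdist_lt ul e e0; have [|N _ HN] := ul e%:C; first by rewrite ltcR.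
  by exists N => n /HN /=; rewrite -rnormE ltcR rdistC.
move=> ul; apply/cvgrPdist_lt => e e0.
(* A positive element of [R[i]] is real, so real radii suffice. *)
have eE : e = (complex.Re e)%:C by rewrite RRe_real // gtr0_real.
move: e0; rewrite eE ltcR => /ul[N HN]; exists N => // n /= Nn.
by rewrite -rnormE ltcR rdistC HN.
Qed.

Lemma cauchy_rnorm_cvg {V : completeNormedModType R[i]} (u : nat -> V) :
  (forall e : R, 0 < e -> exists N, forall n m, (N <= n)%N -> (N <= m)%N ->
     rnorm (u n - u m) < e) ->
  exists l : V, u @ \oo --> l.
Proof.
move=> uC; suff /cvg_ex : cvgn u by [].
apply/cauchy_cvgP/cauchy_ballP => e e0.
have eE : e = (complex.Re e)%:C by rewrite RRe_real // gtr0_real.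
move: e0; rewrite eE ltcR => /uC[N HN].
exists (u @` [set n | (N <= n)%N], u @` [set n | (N <= n)%N]).
  by split; exists N => // n /= Nn; exists n.
move=> [_ _] /= [[n Nn <-] [m Nm <-]].
by rewrite -ball_normE /ball_ /= -rnormE ltcR HN.
Qed.

Lemma invn_lt (e : R) : 0 < e -> exists N, forall n, (N <= n)%N -> n.+1%:R^-1 < e.
Proof.
move=> e0; have [N _ HN] := near_infty_natSinv_lt (PosNum e0).
by exists N => n /HN.
Qed.

End RealNorm.

(** * Cauchy-Schwarz, orthogonality of minimizers and the parallelogram law *)

Section InnerProduct.
Context {R : realType} {H : completeNormedModType R[i]}.
Context {dot : {dot H for Num.conj}} (hdot : induces_norm dot).
Implicit Types u v w x y : H.

Lemma sqr_rnormE u : (rnorm u ^+ 2)%:C = dot u u.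
Proof. by rewrite rmorphXn /= rnormE hdot. Qed.

Lemma dot_conj u v : dot u v = Num.conj (dot v u).
Proof. by rewrite hermC mul1r. Qed.

(** Pythagoras for the orthogonal projection of [w] onto the line spanned by [v]. Since the left
    side is nonnegative, Cauchy-Schwarz follows. *)
Lemma sqr_rnorm_proj w v : v != 0 ->
  rnorm (w - (dot w v / dot v v) *: v) ^+ 2 =
  rnorm w ^+ 2 - rnorm (dot w v) ^+ 2 / rnorm v ^+ 2.
Proof.
(* The computation over an abstract field; [b'] and [b''] stand for conjugated forms of [dot v v],
   which is real. *)
have alg (F : fieldType) (a a' b b' b'' c : F) : b' = b -> b'' = b -> b != 0 ->
    c + a * a' / (b * b') * b - (a' / b' * a + a / b'' * a') = c - a * a' / b.
  by move=> -> -> b0; field.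
move=> v0; apply: complexI.
have d0 : dot v v != 0 by rewrite dnorm_eq0.
have dR : Num.conj (dot v v) = dot v v by rewrite -dot_conj.
rewrite sqr_rnormE rmorphB fmorph_div /= !sqr_rnormE rmorphXn /= rnormE normCK.
rewrite dnormB dnormZ linearZr_LR /= normrM exprMn normCK.
rewrite normfV exprVn normCK.
rewrite !rmorphM /= !fmorphV /= conjCK.
by refine (alg _ _ _ _ _ _ _ dR _ d0); rewrite conjCK.
Qed.

Lemma cauchy_schwarz u v : rnorm (dot u v) <= rnorm u * rnorm v.
Proof.
have [->|v0] := eqVneq v 0; first by rewrite linear0r !rnorm0 mulr0.
have nv0 := rnorm_gt0 v v0.
rewrite -(@ler_pXn2r _ 2) ?nnegrE ?mulr_ge0 ?rnorm_ge0 // exprMn.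
rewrite -ler_pdivrMr ?exprn_gt0 // -subr_ge0 -sqr_rnorm_proj //.
exact: sqr_ge0.
Qed.

(** Testing the projection coefficient is enough: it lowers the squared norm by |<w, v>|^2 / |v|^2,
    which minimality forces to vanish. *)
Lemma dot_eq0_of_min w v :
  (forall a : R[i], rnorm w <= rnorm (w - a *: v)) -> dot w v = 0.
Proof.
have [->|v0] := eqVneq v 0; first by rewrite linear0r.
have nv0 := rnorm_gt0 v v0.
move=> /(_ (dot w v / dot v v)).
rewrite -(@ler_pXn2r _ 2) ?nnegrE ?rnorm_ge0 // sqr_rnorm_proj //.
rewrite lerBrDr gerDl pmulr_lle0 ?invr_gt0 ?exprn_gt0 // => h.
apply/rnorm0_eq0/eqP; rewrite -sqrf_eq0 eq_le h sqr_ge0 //.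
Qed.

Lemma parallelogram u v :
  rnorm (u - v) ^+ 2 + rnorm (u + v) ^+ 2 = (rnorm u ^+ 2 + rnorm v ^+ 2) *+ 2.
Proof.
apply: complexI; rewrite rmorphD rmorphMn rmorphD /= !sqr_rnormE dnormB dnormD.
by rewrite addrACA addNr addr0 mulr2n.
Qed.

End InnerProduct.

(** * Operators with closed graph: surjectivity and bounded inverses *)

Lemma opB {R : realType} {H : completeNormedModType R[i]} {L : operator H} {x y : H} :
  linear_operator L -> dom L x -> dom L y ->
  dom L (x - y) /\ L (x - y) = L x - L y.
Proof.
case=> [_ LD LE] Dx Dy; rewrite addrC -scaleN1r.
by split; [exact: LD | rewrite LE // scaleN1r addrC].
Qed.

Definition closed_graph {R : realType} {H : completeNormedModType R[i]}
    (L : operator H) : Prop :=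
  forall (u : nat -> H) (x y : H), (forall n, dom L (u n)) ->
    u @ \oo --> x -> (fun n => L (u n)) @ \oo --> y -> dom L x /\ L x = y.

Section ClosedRange.
Context {R : realType} {H : completeNormedModType R[i]}.
Context {dot : {dot H for Num.conj}} (hdot : induces_norm dot).

(* The distance from [f] to [M] is attained, by the parallelogram law, at a point
   [p] such that [f - p] is orthogonal to [M]. *)
Lemma subspace_full (M : set H) :
  M 0 -> (forall (a : R[i]) x y, M x -> M y -> M (a *: x + y)) ->
  (forall (u : nat -> H) l, (forall n, M (u n)) -> u @ \oo --> l -> M l) ->
  (forall w, (forall m, M m -> dot w m = 0) -> w = 0) ->
  forall f, M f.
Proof.
move=> M0 Mlin Mcl Mperp f.
pose E := [set rnorm (f - m) ^+ 2 | m in M].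
have lbE : lbound E 0 by move=> _ [m _ <-]; exact: sqr_ge0.
have infE : has_inf E by split; [exists (rnorm (f - 0) ^+ 2), 0 | exists 0].
have infP m : M m -> inf E <= rnorm (f - m) ^+ 2.
  by move=> Mm; apply: ge_inf; [exists 0 | exists m].
have /choice[m mP] n : exists m, M m /\ rnorm (f - m) ^+ 2 < inf E + n.+1%:R^-1.
  have n0 : 0 < n.+1%:R^-1 :> R by rewrite invr_gt0.
  by have [_ [m Mm <-] ltm] := inf_adherent n0 infE; exists m.
(* The midpoint of [m n] and [m k] lies in [M], so its squared distance to [f] is at least [inf E];
   the parallelogram law then leaves only the two excesses over [inf E]. *)
have mC n k : rnorm (m n - m k) ^+ 2 <= 2 * (n.+1%:R^-1 + k.+1%:R^-1).
  have [[Mn ltn] [Mk ltk]] := (mP n, mP k).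
  have := parallelogram hdot (f - m k) (f - m n); rewrite -[in RHS]mulr_natl.
  have -> : f - m k - (f - m n) = m n - m k.
    by rewrite opprB addrC addrA subrK.
  have -> : f - m k + (f - m n) = 2 *: (f - 2^-1 *: (m n + m k)).
    rewrite scalerBr scalerA divff ?pnatr_eq0 // scale1r scaler_nat mulr2n.
    by rewrite addrACA -opprD (addrC (m k)).
  have Mmid : M (2^-1 *: (m n + m k)).
    rewrite -[_ *: _]addr0; apply: (Mlin _ _ 0) => //.
    by rewrite -[m n]scale1r; exact: Mlin.
  have := infP _ Mmid; rewrite rnormZ exprMn.
  have -> : rnorm (2 : R[i]) = 2 by rewrite -(rmorph_nat (real_complex R)) rnorm_real.
  set A := rnorm (f - _ *: _); move: ltn ltk.
  set B := rnorm (f - m n); set C := rnorm (f - m k).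
  move: (rnorm (_ - _)) (n.+1%:R^-1) (k.+1%:R^-1) => D a b.
  clearbody A B C; lra.
have [|p mp] := @cauchy_rnorm_cvg _ _ m.
  (* Two excesses below e^2 / 4 bring the bound [mC] below e^2. *)
  move=> e e0; have [|N HN] := @invn_lt R (e ^+ 2 / 4).
    by rewrite divr_gt0 ?exprn_gt0.
  exists N => n k Nn Nk; rewrite -(@ltr_pXn2r _ 2) ?nnegrE ?rnorm_ge0 // ?ltW //.
  have := mC n k; have := HN n Nn; have := HN k Nk.
  by move: (n.+1%:R^-1) (k.+1%:R^-1) (rnorm _) => a b D; lra.
have Mp : M p by apply: Mcl mp => n; have [] := mP n.
suff /subr0_eq -> : f - p = 0 by [].
apply: Mperp => v Mv; apply: (dot_eq0_of_min hdot) => a.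
rewrite -addrA -opprD (addrC p); set q := _ + p.
have Mq : M q by exact: Mlin.
rewrite leNgt; apply/negP => lt_qp.
(* Half the gap between the two distances. For large [n], [m n] is within [h] of [p], and its
   squared distance to [f] is below |f - q|^2 + h^2 <= (|f - q| + h)^2; the triangle inequality then
   gives |f - p| < |f - q| + 2h = |f - p|. *)
pose h := (rnorm (f - p) - rnorm (f - q)) / 2.
have h0 : 0 < h by rewrite divr_gt0 // subr_gt0.
have [N1 HN1] := (cvg_rnormP _ _).1 mp h h0.
have [|N2 HN2] := @invn_lt R (h ^+ 2); first by rewrite exprn_gt0.
pose n := maxn N1 N2.
have {}HN1 := HN1 n (leq_maxl _ _); have {}HN2 := HN2 n (leq_maxr _ _).
have [_ ltn] := mP n; have leq := infP q Mq.
have : rnorm (f - m n) < rnorm (f - q) + h.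
  rewrite -(@ltr_pXn2r _ 2) ?nnegrE ?addr_ge0 ?rnorm_ge0 // ?ltW //.
  move: (rnorm_ge0 (f - q)) ltn HN2 leq; move: (n.+1%:R^-1) => b.
  set A := rnorm (f - q); set B := rnorm (f - m n); clearbody A B h; nra.
have := ler_rdistD (m n) f p; rewrite /h in HN1 *; lra.
Qed.

(** The range is closed: if the values converge, the lower bound makes the preimages Cauchy, and the
    closed graph identifies the value at their limit. A closed subspace with trivial orthogonal
    complement is the whole space. *)
Lemma surjective_of_bounded_below (L : operator H) (c : R) :
  linear_operator L -> closed_graph L -> 0 < c ->
  (forall x, dom L x -> c * rnorm x <= rnorm (L x)) ->
  (forall w, (forall x, dom L x -> dot w (L x) = 0) -> w = 0) ->
  forall f, exists2 x, dom L x & L x = f.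
Proof.
move=> linL clL c0 Lc Lperp.
have [D0 LD LE] := linL.
apply: subspace_full.
- by have [D00 L00] := opB linL D0 D0; exists (0 - 0) => //; rewrite L00 subrr.
- by move=> a _ _ [x Dx <-] [y Dy <-]; exists (a *: x + y); [exact: LD | exact: LE].
- move=> g l gL gl.
  have /choice[u uP] n : exists x, dom L x /\ L x = g n.
    by have [x Dx Lx] := gL n; exists x.
  have [|x ux] := @cauchy_rnorm_cvg _ _ u.
    move=> e e0; have ce : 0 < c * e / 2 by rewrite !divr_gt0 ?mulr_gt0.
    have [N HN] := (cvg_rnormP _ _).1 gl _ ce.
    exists N => n m Nn Nm; rewrite -(ltr_pM2l c0).
    have [[Dn Ln] [Dm Lm]] := (uP n, uP m).
    have [Dnm Lnm] := opB linL Dn Dm.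
    rewrite (le_lt_trans (Lc _ Dnm)) // Lnm Ln Lm.
    rewrite (le_lt_trans (ler_rdistD l _ _)) //.
    by have := HN n Nn; have := HN m Nm; rewrite (rdistC l); lra.
  have [|||Dx Lx] := clL u x l => //.
  + by move=> n; case: (uP n).
  + rewrite (_ : (fun n => _) = g) //; apply/funext => n.
    by case: (uP n).
  + by exists x.
- move=> w wL; apply: Lperp => x Dx; apply: wL; by exists x.
Qed.

(** The lower bound gives injectivity, so preimages chosen pointwise depend linearly on [f]; it also
    bounds this inverse by [c^-1]. *)
Lemma resolvent_of_bounded_below (S : operator H) (l : R[i]) (c : R) :
  linear_operator S -> 0 < c ->
  (forall x, dom S x -> c * rnorm x <= rnorm (S x - l *: x)) ->
  (forall f, exists2 x, dom S x & S x - l *: x = f) ->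
  resolvent_set S l.
Proof.
move=> linS c0 Sc Ssurj.
have [D0 SD SE] := linS.
have inj x y : dom S x -> dom S y -> S x - l *: x = S y - l *: y -> x = y.
  move=> Dx Dy xy; have [Dxy Sxy] := opB linS Dx Dy.
  apply/subr0_eq/rnorm0_eq0/eqP; rewrite eq_le rnorm_ge0 andbT.
  rewrite -(ler_pM2l c0) mulr0 (le_trans (Sc _ Dxy)) // Sxy scalerBr.
  by rewrite opprD addrACA xy -opprD subrr rnorm0.
have /choice[B BP] f : exists x, dom S x /\ S x - l *: x = f.
  by have [x Dx Sx] := Ssurj f; exists x.
have Blin : linear B.
  move=> a f g; have [[Df Sf] [Dg Sg]] := (BP f, BP g).
  have [Dfg Sfg] := BP (a *: f + g).
  apply: inj => //; first exact: SD.
  rewrite Sfg SE // -{1}Sf -{1}Sg scalerBr scalerDr !scalerA (mulrC l).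
  by rewrite addrACA opprD.
pose Bm := GRing.isLinear.Build _ _ _ _ B Blin.
pose BL : {linear H -> H} := HB.pack B Bm.
exists BL; split=> [|f|x Dx].
- exists c^-1 => f; have [Df Sf] := BP f; rewrite -!rnormE -rmorphM lecR.
  by rewrite ler_pdivlMl // (le_trans (Sc _ Df)) // Sf.
- exact: BP.
- by have [Df Sf] := BP (S x - l *: x); exact: inj.
Qed.

End ClosedRange.

(** * Shifts and perturbations of operators *)

Section Shift.
Context {R : realType} {H : completeNormedModType R[i]}.

Definition shift (T : operator H) (z : R[i]) : operator H :=
  Operator (dom T) (fun x => T x - z *: x).

Lemma linear_shift (T : operator H) (z : R[i]) :
  linear_operator T -> linear_operator (shift T z).
Proof.
case=> [D0 TD TE]; split=> // a x y Dx Dy /=.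
by rewrite TE // scalerBr scalerDr !scalerA (mulrC z) addrACA opprD.
Qed.

Lemma linear_perturb (T A : operator H) : linear_operator T ->
  linear_operator A -> dom T `<=` dom A -> linear_operator (perturb T A).
Proof.
move=> [D0 TD TE] [_ _ AE] TA; split=> // a x y Dx Dy /=.
by rewrite TE // AE; [rewrite scalerDr addrACA | exact: TA | exact: TA].
Qed.

Lemma closed_graph_shift (T : operator H) (z : R[i]) :
  closed_graph T -> closed_graph (shift T z).
Proof.
move=> clT u x y Du ux Tuy.
have [|Dx Tx] := clT u x (y + z *: x) Du ux.
  rewrite (_ : (fun n => T (u n)) =
    (fun n => (shift T z (u n)) + z *: u n)); last first.
    by apply/funext => n; rewrite subrK.
  by apply: cvgD => //; exact: cvgZl_tmp.
by split=> //=; rewrite Tx addrK.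
Qed.

End Shift.

(** * Self-adjoint operators: closedness, and resolvents off the real axis *)

Section SelfAdjoint.
Context {R : realType} {H : completeNormedModType R[i]}.
Context {dot : {dot H for Num.conj}} (hdot : induces_norm dot).
Context {T : operator H} (linT : linear_operator T) (saT : self_adjoint dot T).

Lemma self_adjoint_sym {x y : H} :
  dom T x -> dom T y -> dot (T x) y = dot x (T y).
Proof.
move=> Dx Dy; have [_ TE] := saT.
have : op_graph T (y, T y) by [].
by rewrite -TE; apply.
Qed.

Lemma self_adjoint_domP {x y : H} :
  (forall v, dom T v -> dot (T v) x = dot v y) -> dom T x /\ T x = y.
Proof.
by move=> xy; have [_ TE] := saT; have : adjoint_graph dot T (x, y) by []; rewrite TE.
Qed.

(** The identity <T v, u_n> = <v, T u_n> passes to the limit, so (x, y) lies in the adjoint graph,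
    which is the graph of [T]. *)
Lemma self_adjoint_closed : closed_graph T.
Proof.
move=> u x y Du ux Tuy; apply: self_adjoint_domP => v Dv.
apply/subr0_eq/rnorm0_eq0/eqP; rewrite eq_le rnorm_ge0 andbT.
apply/ler_addgt0Pr => e e0; rewrite add0r.
(* The error will be at most (|v| + |T v|) e / k <= e; the summand 1 keeps [k] positive. *)
pose k := rnorm (T v) + rnorm v + 1.
have k0 : 0 < k by rewrite ltr_wpDl // addr_ge0 ?rnorm_ge0.
have ek : 0 < e / k by rewrite divr_gt0.
have [N1 HN1] := (cvg_rnormP _ _).1 ux _ ek.
have [N2 HN2] := (cvg_rnormP _ _).1 Tuy _ ek.
pose n := maxn N1 N2.
have {}HN1 := HN1 n (leq_maxl _ _); have {}HN2 := HN2 n (leq_maxr _ _).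
(* By symmetry <T v, u_n> and <v, T u_n> cancel, which leaves two small terms for Cauchy-Schwarz. *)
have -> : dot (T v) x - dot v y = dot v (T (u n) - y) - dot (T v) (u n - x).
  rewrite !linearBr /= (self_adjoint_sym Dv (Du n)).
  by rewrite opprB [RHS]addrC addrA subrK.
apply: le_trans (ler_rnormB _ _) _.
have eE : e = k * (e / k) by rewrite mulrC divfK ?gt_eqF.
rewrite [leRHS]eE {1}/k.
have := cauchy_schwarz hdot v (T (u n) - y).
have := cauchy_schwarz hdot (T v) (u n - x).
have := rnorm_ge0 v; have := rnorm_ge0 (T v).
move: HN1 HN2; move: (e / k) ek => d d0.
set a := rnorm v; set b := rnorm (T v); set A := rnorm (u n - x).
set B := rnorm (T (u n) - y); set C := rnorm _; set D := rnorm _.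
clearbody a b A B C D; nra.
Qed.

(** Since <T x, x> is real, <(T - z) x, x> has imaginary part -(Im z) |x|^2; Cauchy-Schwarz bounds
    it by |(T - z) x| |x|. *)
Lemma self_adjoint_bounded_below (z : R[i]) {x : H} : dom T x ->
  `|complex.Im z| * rnorm x <= rnorm (T x - z *: x).
Proof.
move=> Dx; have [->|x0] := eqVneq x 0; first by rewrite rnorm0 mulr0 rnorm_ge0.
rewrite -(ler_pM2r (rnorm_gt0 x x0)) -mulrA -expr2.
apply: le_trans (cauchy_schwarz hdot _ _); apply: le_trans (Im_le_rnorm _).
rewrite linearBl /= linearZl_LR /= -sqr_rnormE //.
have : complex.Im (dot (T x) x) = 0.
  have := @dot_conj _ _ dot (T x) x; rewrite self_adjoint_sym // => h.
  by move: (congr1 (@complex.Im R) h); case: (dot x (T x)) => a b /=; lra.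
case: z => a b; case: (dot _ _) => c d /= ->.
by rewrite mulr0 add0r add0r normrN normrM (ger0_norm (sqr_ge0 _)).
Qed.

Lemma self_adjoint_surjective (z : R[i]) : complex.Im z != 0 ->
  forall f, exists2 x, dom T x & T x - z *: x = f.
Proof.
move=> z0; have z0' : 0 < `|complex.Im z| by rewrite normr_gt0.
apply: (surjective_of_bounded_below hdot (shift T z) _ _ _ z0').
- exact: linear_shift.
- exact/closed_graph_shift/self_adjoint_closed.
- exact: self_adjoint_bounded_below.
(* Orthogonality to the range reads <T v, w> = <v, conj(z) w> for all [v] in the domain, so
   self-adjointness itself puts [w] in the domain. *)
move=> w wT; have [v Dv|Dw Tw] := @self_adjoint_domP w (Num.conj z *: w).
  have := wT v Dv; rewrite /= linearBr /= linearZr_LR /= => /subr0_eq h.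
  by rewrite linearZr_LR /= conjCK dot_conj h rmorphM /= conjCK -dot_conj.
have := self_adjoint_bounded_below (Num.conj z) Dw; rewrite Tw subrr rnorm0.
have -> : `|complex.Im (Num.conj z)| = `|complex.Im z| by case: (z) => a b /=; rewrite normrN.
rewrite (pmulr_rle0 _ z0') => w0.
by apply/rnorm0_eq0/eqP; rewrite eq_le w0 rnorm_ge0.
Qed.

Lemma self_adjoint_resolvent (z : R[i]) :
  complex.Im z != 0 -> resolvent_set T z.
Proof.
move=> z0; apply: (resolvent_of_bounded_below _ _ `|complex.Im z|) => //.
- by rewrite normr_gt0.
- exact: self_adjoint_bounded_below.
- exact: self_adjoint_surjective.
Qed.

End SelfAdjoint.

(** * Perturbations that are small relative to T - z *)

Section Perturbation.
Context {R : realType} {H : completeNormedModType R[i]}.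
Context {dot : {dot H for Num.conj}} (hdot : induces_norm dot).

(** The closed range argument takes the place of a Neumann series: |x + K x| >= |x| / 2, and a [w]
    orthogonal to the range satisfies |w|^2 = -<w, K w> <= |w|^2 / 2, hence vanishes. *)
Lemma id_add_surjective (K : {linear H -> H}) :
  (forall x, rnorm (K x) <= rnorm x / 2) -> forall f, exists x, x + K x = f.
Proof.
move=> Khalf f.
pose L := Operator setT (fun x => x + K x).
have linL : linear_operator L.
  by split=> // a x y _ _ /=; rewrite linearP scalerDr addrACA.
have clL : closed_graph L.
  move=> u x y _ ux Luy; split=> //=.
  have Kux : (fun n => K (u n)) @ \oo --> K x.
    apply/cvg_rnormP => e e0; have [N HN] := (cvg_rnormP _ _).1 ux e e0.
    exists N => n /HN; rewrite -linearB; apply: le_lt_trans.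
    by rewrite (le_trans (Khalf _)) // ler_pdivrMr // ler_peMr ?rnorm_ge0 // ler1n.
  exact: cvg_unique (cvgD ux Kux) Luy.
have half0 : 0 < 2^-1 :> R by rewrite invr_gt0.
have [||x _ Lx] := surjective_of_bounded_below hdot L 2^-1 linL clL half0 _ _ f.
- move=> x _ /=; have := ler_rnormB (x + K x) (K x); rewrite addrK.
  by have := Khalf x; lra.
- move=> w wL; have := wL w I; rewrite /= linearDr /= -sqr_rnormE // => h.
  have hw : rnorm w ^+ 2 = rnorm (dot w (K w)).
    by rewrite -(addr0_eq h) rnormN rnorm_real ?sqr_ge0.
  have := cauchy_schwarz hdot w (K w); rewrite -hw => h1.
  apply/rnorm0_eq0/eqP; rewrite -sqrf_eq0 eq_le sqr_ge0 andbT.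
  have := Khalf w; have := rnorm_ge0 w; nra.
by exists x.
Qed.

Lemma resolvent_perturb (T A : operator H) (z : R[i]) :
  linear_operator T -> linear_operator A -> self_adjoint dot T ->
  dom T `<=` dom A -> complex.Im z != 0 ->
  (forall x, dom T x -> rnorm (A x) <= rnorm (T x - z *: x) / 2) ->
  resolvent_set (perturb T A) z.
Proof.
move=> linT linA saT TA z0 Ahalf.
have Ez x : perturb T A x - z *: x = T x - z *: x + A x by rewrite addrAC.
have [B [_ BT _]] := self_adjoint_resolvent hdot linT saT z z0.
have ABlin : linear (A \o B).
  (* [A] is linear only on its domain; the values of the resolvent [B] lie there, so the composite
     is linear on all of [H]. *)
  have DA f : dom A (B f) by have [Df _] := BT f; exact: TA.
  by case: linA => _ _ AE a f g; rewrite /= linearP AE.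
pose KL := GRing.isLinear.Build _ _ _ _ (A \o B) ABlin.
pose K : {linear H -> H} := HB.pack (A \o B) KL.
have Khalf f : rnorm (K f) <= rnorm f / 2.
  by have [Df Tf] := BT f; rewrite (le_trans (Ahalf _ Df)) // Tf.
(* The constant comes from |(T + A - z) x| >= |(T - z) x| / 2 >= |Im z| |x| / 2. *)
apply: (resolvent_of_bounded_below _ _ (`|complex.Im z| / 2)).
- exact: linear_perturb.
- by rewrite divr_gt0 // normr_gt0.
- move=> x Dx; rewrite Ez.
  have := self_adjoint_bounded_below hdot saT z Dx.
  have := ler_rnormB (T x - z *: x + A x) (A x); rewrite addrK.
  by have := Ahalf x Dx; lra.
- move=> f; have [v vf] := id_add_surjective K Khalf f.
  by have [Dv Tv] := BT v; exists (B v) => //; rewrite Ez Tv.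
Qed.

End Perturbation.

(** * Geometry of the double sector, T-bound zero, and the final estimate *)

Lemma notin_sector_Im {R : realType} (eps : R) : 0 < eps ->
  exists2 s : R, 0 < s & forall z : R[i], z != 0 ->
    ~ sector eps z -> ~ opp_sector eps z -> s * rnorm z <= `|complex.Im z|.
Proof.
(* The cap at pi / 2 puts [e] in ]0, pi[, where sin is positive and cos decreasing; a point outside
   the sector of angle [eps] is also outside that of angle [e]. *)
move=> eps0; pose e := Num.min eps (pi / 2).
have p2 : pi / 2 < pi :> R by have := pi_gt0 R; lra.
have e0 : 0 < e by rewrite lt_min eps0 divr_gt0 ?pi_gt0.
have e2 : e <= pi / 2 by rewrite ge_min lexx orbT.
have epi : e < pi := le_lt_trans e2 p2.
exists (sin e) => [|z z0 zS zN]; first by rewrite sin_gt0_pi // e0.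
have cosE (y : R[i]) : y != 0 -> ~ sector eps y ->
    complex.Re y < rnorm y * cos e.
  move=> y0 yS; have [/andP[argl argr] yE] := argP y0.
  have arge : e < `|arg y|.
    by rewrite gt_min ltNge; apply/orP; left; apply/negP => ?; apply: yS.
  have -> : complex.Re y = rnorm y * cos `|arg y|.
    rewrite {1}yE -rnormE; simpc => /=.
    by case: (ger0P (arg y)) => _; rewrite ?cosN.
  rewrite ltr_pM2l ?rnorm_gt0 // ltr_cos // in_itv /= ?normr_ge0 ?(ltW e0) ?(ltW epi) //.
  by rewrite ler_norml argr andbT ltW.
have c1 := cosE z z0 zS.
have : complex.Re (- z) < rnorm (- z) * cos e.
  by apply: cosE => [|zN']; rewrite ?oppr_eq0 //; apply: zN; exists (- z); rewrite ?opprK.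
rewrite rnormN => c2.
have r0 := rnorm_gt0 z z0.
have r2 : rnorm z ^+ 2 = complex.Re z ^+ 2 + complex.Im z ^+ 2.
  by apply: complexI; rewrite rmorphXn /= rnormE add_Re2_Im2.
have s0 : 0 <= sin e by rewrite ltW // sin_gt0_pi // e0.
rewrite -(@ler_pXn2r _ 2) ?nnegrE ?mulr_ge0 ?(ltW r0) // real_normK ?num_real //.
have := cos2Dsin2 e.
case: z {zS zN z0} r0 r2 c1 c2 => a b /=.
move: (rnorm _) (cos e) (sin e) => r c s r0 r2 c1 c2 cs.
(* The bounds for z and -z give |Re z| < |z| cos e, whence (Im z)^2 >= |z|^2 (1 - cos^2 e) = |z|^2
   sin^2 e. *)
have : a ^+ 2 <= (r * c) ^+ 2 by nra.
by rewrite !exprMn; nra.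
Qed.

Lemma relative_bound0_small {R : realType} {H : completeNormedModType R[i]}
    (T A : operator H) : relatively_bounded T A -> relative_bound T A = 0 ->
  forall e : R, 0 < e -> exists a b : R, [/\ 0 <= a, 0 <= b, b < e &
    forall x, dom T x -> rnorm (A x) <= a * rnorm x + b * rnorm (T x)].
Proof.
move=> [_ nebnd] bnd0 e e0.
have hinf : has_inf (relative_bounds T A).
  by split=> //; exists 0 => b [].
have [b [b0 [a a0 ab]]] := inf_adherent e0 hinf.
rewrite [inf _]bnd0 add0r => be; exists a, b; split=> // x Dx.
have x0 := rnorm_ge0 x; have Tx0 := rnorm_ge0 (T x).
rewrite -(@ler_pXn2r _ 2) ?nnegrE ?addr_ge0 ?mulr_ge0 ?rnorm_ge0 //.
have := ab x Dx; rewrite -!rnormE -!rmorphXn -!rmorphM -rmorphD lecR.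
move/le_trans; apply; rewrite -!exprMn.
have := mulr_ge0 a0 x0; have := mulr_ge0 b0 Tx0; nra.
Qed.

Theorem corollary2p6 (R : realType) (H : completeNormedModType R[i])
    (dot : {dot H for Num.conj}) (hdot : induces_norm dot)
    (T A : operator H)
    (linT : linear_operator T) (linA : linear_operator A)
    (saT : self_adjoint dot T)
    (bndA : relatively_bounded T A) (bnd0 : relative_bound T A = 0) :
  forall eps : R, 0 < eps ->
    exists2 r : R, 0 < r &
      spectrum (perturb T A) `<=` closed_disk0 r `|` sector eps `|` opp_sector eps.
Proof.
move=> eps eps0; have [s s0 sP] := notin_sector_Im eps eps0.
(* Chosen so that 4 b (s + 1) < s, which makes b |T x| at most a quarter of |(T - z) x|. *)
have d0 : 0 < s / (4 * (s + 1)) by rewrite divr_gt0 ?mulr_gt0 ?addr_gt0.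
have [a [b [a0 b0 bd ab]]] := relative_bound0_small T A bndA bnd0 _ d0.
(* Beyond 4 a / s one has 4 a |x| <= s |z| |x| <= |(T - z) x|; the summand 1 makes the radius
   positive even if [a] is 0. *)
exists (4 * a / s + 1).
  by rewrite ltr_wpDl // divr_ge0 ?mulr_ge0 // ltW.
move=> z; apply: contra_notP => /not_orP[/not_orP[zr zS] zN].
have {zr} zr : 4 * a / s + 1 < rnorm z.
  by rewrite ltNge -lecR rnormE; apply/negP.
have z0 : z != 0.
  apply: contraTneq zr => ->; rewrite rnorm0 -leNgt addr_ge0 //.
  by rewrite divr_ge0 ?mulr_ge0 // ltW.
have sz := sP z z0 zS zN.
have rz0 := rnorm_gt0 z z0.
apply: (resolvent_perturb hdot) => //; first by case: bndA.
  by rewrite -normr_gt0 (lt_le_trans _ sz) // mulr_gt0.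
move=> x Dx.
have bb := self_adjoint_bounded_below hdot saT z Dx.
have Ax := ab x Dx.
have Tx : rnorm (T x) <= rnorm (T x - z *: x) + rnorm z * rnorm x.
  by rewrite -rnormZ -{1}(subrK (z *: x) (T x)) ler_rnormD.
have x0 := rnorm_ge0 x.
move: bd zr; rewrite ltr_pdivlMr ?mulr_gt0 ?addr_gt0 // -ltrBrDr ltr_pdivrMr //.
move: Ax Tx bb x0 rz0 sz.
move: (rnorm (A x)) (rnorm (T x)) (rnorm (_ - _)) (rnorm x) (rnorm z) (`|_|).
(* Now [v] is |(T - z) x| and [y] is |Im z|. The two terms [a * nx] and [b * nT] are each shown to
   be at most v / 4. *)
move=> nA nT v nx nz y Ax Tx bb x0 rz0 sz bd zr.
have szx : s * nz * nx <= v by rewrite (le_trans _ bb) // ler_wpM2r.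
have ax : 4 * (a * nx) <= v.
  by have := ler_wpM2r x0 (ltW zr); have := mulr_ge0 (ltW s0) x0; lra.
have v0 : 0 <= v.
  by rewrite (le_trans _ szx) // !mulr_ge0 // ltW.
have bT : s * (b * nT) <= b * (s + 1) * v.
  have := ler_wpM2l (mulr_ge0 (ltW s0) b0) Tx; have := ler_wpM2l b0 szx; lra.
have : s * (4 * (b * nT)) <= s * v.
  by have := ler_wpM2r v0 (ltW bd); lra.
by rewrite ler_pM2l //; lra.
Qed.
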